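(* Let $\lambda$ be a cardinal with $\lambda=\lambda^{\aleph_0}\ge 2^{\aleph_0}$. Then there is a reduced torsion-free group $G$ of cardinality $\lambda$ such that every reduced torsion-free group of cardinality at most $\lambda$ is isomorphic to a subgroup of $G$.
   Context: Groups are infinite abelian groups. A group is reduced if it has no nonzero divisible subgroup. *)

(* Defs.v *)
From HB Require Import structures.
From mathcomp Require Import all_boot all_order all_algebra.
From mathcomp Require Import boolp classical_sets functions cardinality.

Set Implicit Arguments.
Unset Strict Implicit.
Unset Printing Implicit Defensive.

Import GRing.Theory.

Local Open Scope classical_set_scope.
Local Open Scope ring_scope.

(* With the axioms of [boolp], every subset of G is given by a {pred G}. *)
Definition is_subgroup (G : zmodType) (K : {pred G}) : Prop := zmod_closed K.

Definition is_divisible (G : zmodType) (D : {pred G}) : Prop :=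
  forall (n : nat) (x : G), (0 < n)%N -> x \in D ->
  exists2 y, y \in D & y *+ n = x.

Definition is_reduced (G : zmodType) : Prop :=
  ~ exists D : {pred G},
      [/\ is_subgroup D, is_divisible D & exists2 x, x \in D & x != 0].

Definition is_torsion_free (G : zmodType) : Prop :=
  forall (n : nat) (x : G), (0 < n)%N -> x *+ n = 0 -> x = 0.

Definition isomorphic_to_subgroup (H G : zmodType) : Prop :=
  exists2 K : {pred G}, is_subgroup K &
  exists f : {additive H -> G}, set_bij [set: H] [set` K] f.

(* Main.v *)
(** For torsion-free [H] let [E] be the quotient of the rational hull of [H] by
    [H]. Sending [x] to the homomorphism [q |-> q x] from Q/Z to [E] has kernel
    the intersection of the subgroups [n H], which is zero when [H] is reduced.
    Index coordinates by an injection of [E] into [L]. Then [E] embeds in the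
    group [A] of countably supported functions from [L] to Q/Z: a maximal
    partial embedding whose values are supported on its own domain is defined
    everywhere, because a missing element [b], of order [m] modulo the domain,
    can be sent to a solution of [m a' = a] (where [a] is the image of [m b])
    plus an element of order [m] placed on the unused coordinate [b]. Hence [H]
    embeds in [G = Hom(Q/Z, A)]. This [G] is reduced and torsion-free whatever
    [A] is, because Q/Z is torsion and divisible, and it has cardinality
    [L ^ aleph_0 = L]. *)

Require Import Defs.
From HB Require Import structures.
From mathcomp Require Import all_boot all_order all_algebra.
From mathcomp Require Import boolp classical_sets functions cardinality.

Set Implicit Arguments.
Unset Strict Implicit.
Unset Printing Implicit Defensive.

Import GRing.Theory Num.Theory.

Local Open Scope classical_set_scope.
Local Open Scope card_scope.
Local Open Scope ring_scope.
Local Open Scope quotient_scope.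

(** * Torsion elements embedded into countably supported functions *)

Definition is_torsion (B : zmodType) (b : B) : Prop :=
  exists2 m, (0 < m)%N & b *+ m = 0.

Lemma countableU (T : Type) (A B : set T) :
  countable A -> countable B -> countable (A `|` B).
Proof.
move=> cA cB; pose F b := if b then A else B.
suff -> : A `|` B = \bigcup_(b in [set: bool]) F b.
  by apply: bigcup_countable => // -[].
apply/seteqP; split=> [x [Ax|Bx]|x [[] _ Fx]]; [| |by left|by right].
  by exists true.
by exists false.
Qed.

Definition supp (L : Type) (T : zmodType) (a : L -> T) : set L :=
  [set i | a i != 0].

Lemma supp0 (L : Type) (T : zmodType) : supp (0 : L -> T) = set0.
Proof. by apply/seteqP; split=> i; rewrite /supp/= ?eqxx. Qed.

Section TorsionEmbedding.

Variables (B T : zmodType) (L : Type) (iota : B -> L).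
Hypothesis iota_inj : injective iota.
Hypothesis T_divisible : forall m (a : T), (0 < m)%N -> exists a', a' *+ m = a.
Hypothesis T_order :
  forall m, (0 < m)%N -> exists t : T, forall k, t *+ k = 0 <-> (m %| k)%N.

(* [Gam] is the graph of an injective homomorphism from a subgroup of [B], whose
   values only use the coordinates indexed by that subgroup; this leaves room
   for extensions. *)
Definition partial_embedding (Gam : set (B * (L -> T))) : Prop :=
  [/\ forall x y, Gam x -> Gam y -> Gam (x - y),
      forall x, Gam x -> x.2 = 0 <-> x.1 = 0,
      forall x, Gam x -> countable (supp x.2) &
      forall x, Gam x -> supp x.2 `<=` [set iota y.1 | y in Gam]].

(** Each condition involves at most two elements of the graph, so it passes to unions of chains and
    Zorn's lemma applies. *)
Lemma maximal_partial_embedding :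
  exists Gam, [/\ partial_embedding Gam, Gam 0 &
    forall Gam', partial_embedding Gam' -> Gam `<=` Gam' -> Gam' `<=` Gam].
Proof.
have [F FP totF|Gam [GamP Gmax]] := @Zorn_bigcup _ partial_embedding.
  split.
  - move=> x y [X FX Xx] [Y FY Yy].
    have [XY|YX] := totF X Y FX FY.
      by exists Y => //; case: (FP _ FY) => + _ _ _; apply=> //; apply: XY.
    by exists X => //; case: (FP _ FX) => + _ _ _; apply=> //; apply: YX.
  - by move=> x [X FX Xx]; case: (FP _ FX) => _ + _ _; apply.
  - by move=> x [X FX Xx]; case: (FP _ FX) => _ _ + _; apply.
  - move=> x [X FX Xx] i xi; case: (FP _ FX) => _ _ _ /(_ _ Xx i xi)[y Xy <-].
    by exists y => //; exists X.
have maxE Gam' : partial_embedding Gam' -> Gam `<=` Gam' -> Gam' `<=` Gam.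
  move=> P' sub; have [//|nsub] := pselect (Gam' `<=` Gam).
  by case: (Gmax Gam').
exists Gam; split=> //.
(* The empty graph is vacuously a partial embedding, so [Gam 0] needs an argument: an empty [Gam]
   would be properly extended by [[set 0]]. *)
have [[x Gx]|/forallNP G0] := pselect (exists x, Gam x).
  by case: GamP => /(_ x x Gx Gx); rewrite subrr.
suff P0 : partial_embedding [set 0] by apply: (maxE _ P0 _ 0 erefl) => x /G0.
split=> [x y -> ->|x ->|x ->|x ->] //=; first by rewrite subrr.
  by rewrite supp0.
by rewrite supp0.
Qed.

Lemma partial_embeddingD Gam x y :
  partial_embedding Gam -> Gam 0 -> Gam x -> Gam y -> Gam (x + y).
Proof.
case=> sub _ _ _ G0 Gx Gy; rewrite -[y]opprK -[- y]sub0r.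
exact: sub (sub _ _ _ _).
Qed.

Lemma partial_embeddingMn Gam x k :
  partial_embedding Gam -> Gam 0 -> Gam x -> Gam (x *+ k).
Proof.
move=> P G0 Gx; elim: k => [|k IH]; first by rewrite mulr0n.
by rewrite mulrS; apply: partial_embeddingD.
Qed.

Lemma maximal_partial_embedding_torsion Gam b :
    partial_embedding Gam -> Gam 0 ->
    (forall Gam', partial_embedding Gam' -> Gam `<=` Gam' -> Gam' `<=` Gam) ->
  is_torsion b -> exists a, Gam (b, a).
Proof.
move=> P G0 Gmax [m0 m0_gt0 bm0]; apply: contrapT => /forallNP nb.
have [Gsub G00 Gcount Gsupp] := P.
pose Q m := (0 < m)%N && `[< exists a, Gam (b *+ m, a) >].
have exQ : exists m, Q m.
  by exists m0; rewrite /Q m0_gt0; apply/asboolP; exists 0; rewrite bm0.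
have [m /andP[m_gt0 /asboolP[a Ga]] m_min] := ex_minnP exQ.
(* A nonzero remainder of [k] modulo [m] would be a smaller positive multiplier sending [b] into the
   domain. *)
have mdvd k : (exists a, Gam (b *+ k, a)) -> (m %| k)%N.
  move=> [c Gc]; apply: contraT; rewrite /dvdn -lt0n => km.
  have: (m <= k %% m)%N.
    apply: m_min; rewrite /Q km; apply/asboolP.
    exists (c - a *+ (k %/ m)).
    have := Gsub _ _ Gc (partial_embeddingMn (k %/ m) P G0 Ga).
    congr Gam; apply: injective_projections.
      rewrite /= (raddfMn fst) /= {1}(divn_eq k m) mulrnDr mulnC mulrnA addrAC subrr.
      by rewrite add0r.
    by rewrite /= (raddfMn snd).
  by rewrite leqNgt ltn_mod m_gt0.
(* Taking the root [0] wherever [a] vanishes keeps the support countable and leaves the coordinate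
   [iota b] free. *)
have /choice[a' a'E] : forall i, exists u, u *+ m = a i /\ (a i = 0 -> u = 0).
  move=> i; have [ai0|ai] := pselect (a i = 0).
    by exists 0; rewrite mul0rn.
  by have [u uE] := T_divisible (a i) m_gt0; exists u.
have [t t_ord] := T_order m_gt0.
have tm0 : t *+ m = 0 by apply/t_ord.
pose a'' : L -> T := fun i => a' i + (if `[< i = iota b >] then t else 0).
have a''m : a'' *+ m = a.
  apply/funext => i; rewrite natmulfctE /a'' mulrnDl (a'E i).1.
  by case: ifP; rewrite ?tm0 ?mul0rn addr0.
pose v : B * (L -> T) := (b, a'').
have Gvm : Gam (v *+ m).
  by move: Ga; congr Gam; apply: injective_projections;
    rewrite ?(raddfMn fst) ?(raddfMn snd) ?a''m.
have Gvdvd k : (m %| k)%N -> Gam (v *+ k).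
  by move=> /dvdnP[q ->]; rewrite mulnC mulrnA; apply: partial_embeddingMn.
(* No element of [Gam] uses the coordinate [iota b], so there it remains free
   to detect the multiples of [b]. *)
have Gfib x : Gam x -> x.2 (iota b) = 0.
  move=> Gx; apply: contrapT => /eqP xb.
  have [[c u] Gy /iota_inj cb] := Gsupp _ Gx _ xb.
  by apply: (nb u); rewrite -cb.
pose Gam' := [set z | exists x k, Gam x /\ z = x + v *+ k].
have GG' : Gam `<=` Gam'.
  by move=> x Gx; exists x, 0%N; split=> //; rewrite addr0.
have Gv : Gam' v by exists 0, 1%N; split=> //; rewrite add0r.
suff P' : partial_embedding Gam'.
  by apply: (nb a''); apply: (Gmax Gam').
split.
- move=> _ _ [x [k [Gx ->]]] [y [l [Gy ->]]].
  (* Multipliers are natural numbers, so [- l] is written as [m.-1 * l - m * l], and [v *+ (m * l)]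
     is already in [Gam]. *)
  exists (x - y - v *+ (m * l)), (k + m.-1 * l)%N; split.
    exact: Gsub (Gsub _ _ Gx Gy) (Gvdvd _ (dvdn_mulr _ (dvdnn m))).
  rewrite -{1}[m]prednK// mulSn !mulrnDr; set s := v *+ (_.-1 * _).
  rewrite opprD [- (_ + s)]opprD [_ *+ k + s]addrC !addrA subrK.
  by rewrite [x + _ - y]addrAC addrAC.
- move=> _ [x [k [Gx ->]]] /=; rewrite (raddfMn fst) (raddfMn snd) /=.
  (* If [m] divides [k], the pair lies in [Gam]. So each direction only needs this divisibility: it
     comes from the order of [t] at coordinate [iota b], or from [mdvd]. *)
  have dvdP : (m %| k)%N -> x.2 + a'' *+ k = 0 <-> x.1 + b *+ k = 0.
    move=> /Gvdvd Gvk; have := G00 _ (partial_embeddingD P G0 Gx Gvk).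
    by rewrite /= (raddfMn fst) (raddfMn snd).
  split=> h; apply/dvdP => //.
    apply/t_ord; have := congr1 (@^~ (iota b)) h.
    rewrite natmulfctE /= [LHS]/= => {h}.
    change (x.2 (iota b) + a'' (iota b) *+ k = 0 -> t *+ k = 0).
    have ab0 : a (iota b) = 0 by apply: (Gfib _ Ga).
    by rewrite Gfib// /a'' (a'E _).2// asboolT// !add0r.
  apply: mdvd; exists (- x.2); have := Gsub _ _ G0 Gx; congr Gam.
  apply: injective_projections; rewrite /= sub0r //.
  by apply/esym/eqP; rewrite -addr_eq0 addrC h.
- move=> _ [x [k [Gx ->]]] /=.
  apply: (sub_countable (B := supp x.2 `|` (supp a `|` [set iota b]))).
    apply/subset_card_le => i; rewrite /supp /= => xi; apply: contrapT.
    move=> /not_orP[/negP/negPn/eqP xi0 /not_orP[/negP/negPn/eqP ai0 ib]].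
    move: xi; rewrite (raddfMn snd) natmulfctE.
    change (x.2 i + a'' i *+ k != 0 -> False).
    by rewrite xi0 /a'' (a'E _).2// asboolF// !add0r mul0rn eqxx.
  apply: countableU; first exact: Gcount.
  by apply: countableU; [exact: (Gcount _ Ga)|exact: countable1].
- move=> _ [x [k [Gx ->]]] i; rewrite /supp /= => xi.
  have [/eqP xi0|xi0] := boolP (x.2 i == 0); last first.
    by have [y Gy <-] := Gsupp _ Gx _ xi0; exists y => //; apply: GG'.
  have [->|ib] := pselect (i = iota b); first by exists v.
  have [/eqP ai0|ai0] := boolP (a i == 0); last first.
    by have [y Gy <-] := Gsupp _ Ga _ ai0; exists y => //; apply: GG'.
  move: xi; rewrite (raddfMn snd) natmulfctE.
  change (x.2 i + a'' i *+ k != 0 -> [set iota y.1 | y in Gam'] i).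
  by rewrite xi0 /a'' (a'E _).2// asboolF// !add0r mul0rn eqxx.
Qed.

(** [B] need not be torsion: the domain of a maximal graph contains all torsion elements, and
    additivity and injectivity are claimed only there. *)
Lemma torsion_embedding : exists Phi : B -> L -> T,
  [/\ forall b, countable (supp (Phi b)),
      forall b c, is_torsion b -> is_torsion c -> Phi (b - c) = Phi b - Phi c &
      forall b, is_torsion b -> Phi b = 0 -> b = 0].
Proof.
have [Gam [P G0 Gmax]] := maximal_partial_embedding.
have tor := maximal_partial_embedding_torsion P G0 Gmax.
have [Gsub G00 Gcount _] := P.
have Gfun b a a' : Gam (b, a) -> Gam (b, a') -> a = a'.
  move=> Ga Ga'; apply/eqP; rewrite -subr_eq0; apply/eqP.
  by apply/(G00 _ (Gsub _ _ Ga Ga')); rewrite /= subrr.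
(* Off the domain the default value [0] still has countable support. *)
have /choice[Phi PhiP] b : exists a, (exists a', Gam (b, a')) /\ Gam (b, a) \/
    ~ (exists a', Gam (b, a')) /\ a = 0.
  have [[a Ga]|nG] := pselect (exists a', Gam (b, a')).
    by exists a; left; split=> //; exists a.
  by exists 0; right.
have PhiG b a : Gam (b, a) -> Phi b = a.
  by move=> Ga; have [[_ /Gfun]|[[]]] := PhiP b; [apply|exists a].
exists Phi; split=> [b|b c /tor[u Gu] /tor[u' Gu']|b /tor[u Gu]].
- by have [[_ /Gcount]//|[_ ->]] := PhiP b; rewrite supp0.
- by rewrite (PhiG _ _ Gu) (PhiG _ _ Gu') (PhiG _ _ (Gsub _ _ Gu Gu')).
- by rewrite (PhiG _ _ Gu) => u0; apply/(G00 _ Gu).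
Qed.

End TorsionEmbedding.

Lemma card_leT_inj (X Y : Type) :
  [set: X] #<= [set: Y] <-> exists f : X -> Y, injective f.
Proof.
split=> [/card_leP[f]|[f f_inj]].
  exists (fun x => val (f (SigSub (mem_set (I : [set: X] x))))) => x y.
  by move=> /val_inj /'inj_f => /(_ (mem_set I) (mem_set I))/(congr1 val).
have /injfunPex[g] : exists2 g : X -> Y, set_fun [set: X] [set: Y] g &
    set_inj [set: X] g by exists f => // x y _ _ /f_inj.
exact: inj_card_le g.
Qed.

(** * The group of homomorphisms from Q/Z and its cardinality *)

Section UniversalGroup.

Variables (L : Type) (T : zmodType).

(* [f n] is the image of [1/n!] under a homomorphism from Q/Z to the functions
   [L -> T] with countable support. *)
Definition univ_pred : {pred nat -> L -> T} := fun f =>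
  `[< [/\ f 0%N = 0, forall n, f n.+1 *+ n.+1 = f n &
          forall n, countable (supp (f n))] >].

Lemma univ_zmod_closed : zmod_closed univ_pred.
Proof.
split; first apply/asboolP; first split=> // n.
- by rewrite mul0rn.
- by rewrite supp0.
move=> f g /asboolP[f0 fS fc] /asboolP[g0 gS gc]; apply/asboolP; split.
- by change (f 0%N - g 0%N = 0); rewrite f0 g0 subrr.
- move=> n; change ((f n.+1 - g n.+1) *+ n.+1 = f n - g n).
  by rewrite mulrnBl fS gS.
move=> n; apply: sub_countable (countableU (fc n) (gc n)).
apply/subset_card_le => i; rewrite /supp /= => fgi; apply: contrapT.
move=> /not_orP[/negP/negPn/eqP fi /negP/negPn/eqP gi].
move: fgi; change (f n i - g n i != 0 -> False).
by rewrite fi gi subrr eqxx.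
Qed.

HB.instance Definition _ :=
  GRing.isZmodClosed.Build _ univ_pred univ_zmod_closed.

Record univ := Univ {
  univ_val : nat -> L -> T; univ_valP : univ_val \in univ_pred }.

HB.instance Definition _ := [isSub for univ_val].
HB.instance Definition _ := [Choice of univ by <:].
HB.instance Definition _ := [SubChoice_isSubZmodule of univ by <:].

Implicit Types g : univ.

Lemma univ_val0 g : univ_val g 0%N = 0.
Proof. by have /asboolP[] := univ_valP g. Qed.

Lemma univ_valS g n : univ_val g n.+1 *+ n.+1 = univ_val g n.
Proof. by have /asboolP[] := univ_valP g. Qed.

Lemma univ_val_countable g n : countable (supp (univ_val g n)).
Proof. by have /asboolP[] := univ_valP g. Qed.

Lemma univ_valMn g m n : univ_val (g *+ m) n = univ_val g n *+ m.
Proof.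
have -> : univ_val (g *+ m) = univ_val g *+ m by exact: (raddfMn val).
by rewrite natmulfctE.
Qed.

Lemma univ_torsion g n : univ_val g n *+ n`! = 0.
Proof.
by elim: n => [|n IH]; rewrite ?univ_val0 ?mul0rn// factS mulrnA univ_valS.
Qed.

Lemma univ_val_ge g n k : exists c, univ_val g n = univ_val g (n + k) *+ c.
Proof.
elim: k => [|k [c ->]]; first by exists 1%N; rewrite addn0.
by exists ((n + k).+1 * c)%N; rewrite addnS mulrnA univ_valS.
Qed.

Lemma univ_torsion_free : is_torsion_free univ.
Proof.
move=> m g m_gt0 gm0; apply: val_inj; apply/funext => n /=.
(* With [N = m * n.+1], the value at [N.-1] is [N] times the value at [N], hence killed along with
   [g *+ m]; and [n <= N.-1], so the value at [n] is a multiple of it. *)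
have N_gt0 : (0 < m * n.+1)%N by rewrite muln_gt0 m_gt0.
have n_le : (n <= (m * n.+1).-1)%N.
  by rewrite -ltnS prednK//; apply: leq_pmull.
have [c ->] := univ_val_ge g n ((m * n.+1).-1 - n).
rewrite subnKC// -univ_valS prednK// mulrnA -univ_valMn gm0.
by rewrite -[0 *+ _]/(0 *+ _) !mul0rn.
Qed.

(** An element divisible by [n!] vanishes at index [n], since all values there are killed by
    [n!]. *)
Lemma univ_reduced : is_reduced univ.
Proof.
move=> [D [_ Ddiv [g Dg]]]; apply/negP/negPn/eqP.
apply: val_inj; apply/funext => n /=.
have [y _ <-] := Ddiv _ _ (fact_gt0 n) Dg.
by rewrite univ_valMn univ_torsion.
Qed.

(** The sequence [tau] encodes a nonzero homomorphism from Q/Z to [T]; placing it on a single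
    coordinate gives one element for each point of [L]. *)
Lemma univ_ge (tau : nat -> T) :
    tau 0%N = 0 -> (forall n, tau n.+1 *+ n.+1 = tau n) -> tau 2%N != 0 ->
  [set: L] #<= [set: univ].
Proof.
move=> tau0 tauS tau2; apply/card_leT_inj.
pose del (i : L) (n : nat) (j : L) := if `[< j = i >] then tau n else 0.
have delP i : del i \in univ_pred.
  apply/asboolP; split=> [|n|n].
  - by apply/funext => j; rewrite /del tau0 if_same.
  - apply/funext => j; rewrite natmulfctE /del.
    by case: ifP; rewrite ?mul0rn ?tauS.
  apply: sub_countable (countable1 i); apply/subset_card_le => j.
  by rewrite /supp /del /=; case: asboolP => //; rewrite eqxx.
exists (fun i => Univ (delP i)) => i j [] /(congr1 (fun f => f 2%N i)).
rewrite /del asboolT//; case: asboolP => // _ t0.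
by rewrite t0 eqxx in tau2.
Qed.

(** Each value is coded by an enumeration covering its support together with the values along it;
    [cL] packs pairs and sequences into points of [L]. *)
Lemma univ_le (cL : (nat -> L) -> L) (cT : T -> L) (i0 : L) :
  injective cL -> injective cT -> [set: univ] #<= [set: L].
Proof.
move=> cL_inj cT_inj; apply/card_leT_inj.
have enumP g n : exists e : nat -> L, supp (univ_val g n) `<=` range e.
  have /pfcard_geP[->|[e]] := univ_val_countable g n; first by exists (fun=> i0).
  by exists e => i /'surj_e[k _ <-]; exists k.
have /choice[e eP] : forall gn : univ * nat, exists e : nat -> L,
  supp (univ_val gn.1 gn.2) `<=` range e by move=> [g n]; apply: enumP.
pose pair (x y : L) := cL (fun k => if k is 0%N then x else y).
have pair_inj x y x' y' : pair x y = pair x' y' -> x = x' /\ y = y'.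
  by move=> /cL_inj h; rewrite [x](congr1 (@^~ 0%N) h) [y](congr1 (@^~ 1%N) h).
exists (fun g => cL (fun n => cL (fun k =>
  pair (e (g, n) k) (cT (univ_val g n (e (g, n) k)))))) => g g'.
move=> /cL_inj gg'; apply: val_inj; apply/funext => n; apply/funext => i /=.
have {}gg' k : e (g, n) k = e (g', n) k /\
    univ_val g n (e (g, n) k) = univ_val g' n (e (g, n) k).
  have /cL_inj/(congr1 (@^~ k))/pair_inj[ek /cT_inj gk] := congr1 (@^~ n) gg'.
  by split=> //; rewrite gk ek.
(* A coordinate in either support is enumerated, and equal codes give equal values there; outside
   both supports both values are [0]. *)
have [/(eP (g, n))[k _ /= <-]|/negP/negPn/eqP gi] := pselect (supp (univ_val g n) i).
  by rewrite (gg' k).2.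
have [/(eP (g', n))[k _ /= <-]|/negP/negPn/eqP g'i] := pselect (supp (univ_val g' n) i).
  by rewrite -(gg' k).1 (gg' k).2.
by rewrite gi g'i.
Qed.

End UniversalGroup.

(** * The rational hull of a torsion-free group modulo the group *)

Lemma quot_pi_eq0 (R : zmodType) (I : zmodClosed R) (x : R) :
  \pi_(Quotient.quot I) x = 0 <-> x \in I.
Proof.
rewrite -(raddf0 \pi_(Quotient.quot I)).
split=> [/eqmodP x0|x0]; last by apply/eqmodP; rewrite /= /Quotient.equiv subr0.
by have : x - 0 \in I := x0; rewrite subr0.
Qed.

Section EventuallyDivisible.

Variable H : zmodType.
Hypothesis H_torsion_free : is_torsion_free H.

(** The quotient by this subgroup identifies sequences that agree modulo [N! H] for all large [N].
    It contains the hull modulo [H] without requiring the hull to be built. *)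
Definition ev_divisible : {pred nat -> H} := fun f =>
  `[< exists M, forall N, (M <= N)%N -> exists y, f N = y *+ N`! >].

Lemma ev_divisible_zmod_closed : zmod_closed ev_divisible.
Proof.
split; first by apply/asboolP; exists 0%N => N _; exists 0; rewrite mul0rn.
move=> f g /asboolP[M fM] /asboolP[M' gM']; apply/asboolP.
exists (maxn M M') => N; rewrite geq_max => /andP[/fM[y fN] /gM'[z gN]].
by exists (y - z); rewrite mulrnBl -fN -gN.
Qed.

HB.instance Definition _ :=
  GRing.isZmodClosed.Build _ ev_divisible ev_divisible_zmod_closed.

Definition frac_quot : zmodType := Quotient.quot ev_divisible.

(* The class of [x / n!] modulo [H]: multiplication by [N!] maps
   [((1/N!) H) / H] isomorphically onto [H / N! H], so these classes become sequences indexed by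
   [N], compared for large [N]. For [N < n] the coefficient is the junk value
   [1]. *)
Definition frac n (x : H) : frac_quot :=
  \pi_(Quotient.quot ev_divisible) (fun N => x *+ (N ^_ (N - n))).

Lemma frac_is_zmod_morphism n x y : frac n (x - y) = frac n x - frac n y.
Proof.
rewrite /frac -raddfB; congr (\pi _); apply/funext => N.
exact: mulrnBl.
Qed.

(** For [n <= N] the coefficient is [N! / n!], which torsion-freeness allows to be cancelled. *)
Lemma frac_eq0 n x : frac n x = 0 <-> exists y, x = y *+ n`!.
Proof.
have ffE N : (n <= N)%N -> (n`! * N ^_ (N - n))%N = N`!.
  by move=> nN; rewrite -[RHS](ffact_fact (leq_subr n N)) subKn// mulnC.
split=> [/quot_pi_eq0/asboolP[M xM]|[y ->]]; last first.
  apply/quot_pi_eq0/asboolP; exists n => N nN; exists y.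
  by rewrite -mulrnA ffE.
have [y xy] := xM _ (leq_maxl M n); exists y; apply/eqP; rewrite -subr_eq0.
apply/eqP; apply: (@H_torsion_free (maxn M n ^_ (maxn M n - n))).
  by rewrite ffact_gt0 leq_subr.
by rewrite mulrnBl xy -mulrnA ffE ?leq_maxr// subrr.
Qed.

Lemma frac0 x : frac 0 x = 0.
Proof. by apply/frac_eq0; exists x. Qed.

Lemma fracS n x : frac n.+1 x *+ n.+1 = frac n x.
Proof.
apply/eqP; rewrite -subr_eq0 /frac -raddfMn -raddfB.
apply/eqP/quot_pi_eq0/asboolP; exists n.+1 => N nN.
exists 0; rewrite mul0rn; apply/eqP.
change (((fun N => x *+ (N ^_ (N - n.+1))) *+ n.+1) N - x *+ (N ^_ (N - n)) == 0).
by rewrite natmulfctE -mulrnA -{2}(subKn nN) -ffactnSr subnSK// subrr.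
Qed.

Lemma frac_torsion n x : is_torsion (frac n x).
Proof.
exists n`!; first exact: fact_gt0.
by elim: n => [|n IH]; rewrite ?frac0 ?mul0rn// factS mulrnA fracS.
Qed.

Lemma frac_quot_inj : exists f : frac_quot -> (nat -> H), injective f.
Proof.
exists repr => x y /(congr1 \pi_(Quotient.quot ev_divisible)).
by rewrite !reprK.
Qed.

(** The elements divisible by every positive integer form a divisible subgroup: in a torsion-free
    group quotients are unique, so the quotient of [z] by [m] inherits divisibility by [n] from that
    of [z] by [n * m]. *)
Lemma reduced_meet_fact :
  is_reduced H -> forall x : H, (forall n, exists y, x = y *+ n`!) -> x = 0.
Proof.
move=> H_red x x_div; apply: contrapT => /eqP x0; apply: H_red.
exists (fun z => `[< forall n, (0 < n)%N -> exists y, z = y *+ n >]); split.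
- split.
    by apply/asboolP => n _; exists 0; rewrite mul0rn.
  move=> u v /asboolP uD /asboolP vD; apply/asboolP => n n0.
  have [[y ->] [z ->]] := (uD n n0, vD n n0).
  by exists (y - z); rewrite mulrnBl.
- move=> m z m0 /asboolP zD; have [y zy] := zD m m0.
  exists y => //; apply/asboolP => n n0.
  have [|w zw] := zD (n * m)%N; first by rewrite muln_gt0 n0.
  exists w; apply/eqP; rewrite -subr_eq0; apply/eqP; apply: H_torsion_free m0 _.
  by rewrite mulrnBl -zy -mulrnA -zw subrr.
exists x => //; apply/asboolP => -[//|n] _; have [y ->] := x_div n.+1.
by exists (y *+ n`!); rewrite -mulrnA mulnC factS.
Qed.

End EventuallyDivisible.

(** * Embedding a reduced torsion-free group *)

Section Embedding.

Variables (L : Type) (T H : zmodType).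
Hypothesis T_divisible : forall m (a : T), (0 < m)%N -> exists a', a' *+ m = a.
Hypothesis T_order :
  forall m, (0 < m)%N -> exists t : T, forall k, t *+ k = 0 <-> (m %| k)%N.
Hypotheses (H_reduced : is_reduced H) (H_torsion_free : is_torsion_free H).

(** The coordinates must accommodate [nat -> H] because [frac_quot] is a quotient of it. The kernel
    is the intersection of the subgroups [n! H], which is zero. *)
Lemma univ_embedding (cH : (nat -> H) -> L) :
  injective cH -> exists f : {additive H -> univ L T}, injective f.
Proof.
move=> cH_inj; have [r r_inj] := @frac_quot_inj H.
have [Phi [Phi_count PhiB Phi0]] :=
  torsion_embedding (inj_comp cH_inj r_inj) T_divisible T_order.
have frac_tor := frac_torsion H_torsion_free.
have PhiZ : Phi 0 = 0.
  have tor0 : is_torsion (0 : frac_quot H) by exists 1%N; rewrite ?mul0rn.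
  by have := PhiB 0 0 tor0 tor0; rewrite !subrr.
have PhiMn n x k : Phi (frac n x *+ k) = Phi (frac n x) *+ k.
  have torMn j : is_torsion (frac n x *+ j).
    have [m m0 xm] := frac_tor n x.
    by exists m => //; rewrite -mulrnA mulnC mulrnA xm mul0rn.
  elim: k => [|k IH]; first by rewrite !mulr0n.
  rewrite [RHS]mulrSr -IH; apply/eqP; rewrite -subr_eq; apply/eqP.
  by rewrite -PhiB // mulrSr addrK.
pose phi0 x n := Phi (frac n x).
have phi0P x : phi0 x \in @univ_pred L T.
  apply/asboolP; split=> [|n|n]; rewrite /phi0 ?frac0 //.
  by rewrite -PhiMn fracS.
pose phi x : univ L T := Univ (phi0P x).
have phiB : zmod_morphism phi.
  move=> x y; apply: val_inj; apply/funext => n /=.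
  by rewrite /phi0 frac_is_zmod_morphism PhiB.
pose F : {additive H -> univ L T} :=
  HB.pack phi (GRing.isZmodMorphism.Build _ _ phi phiB).
exists F; apply/raddf_inj => x Fx0; apply: reduced_meet_fact => // n.
apply/frac_eq0 => //; apply: Phi0 => //.
by have := congr1 (fun g => univ_val g n) Fx0.
Qed.

End Embedding.

(** * The group Q/Z *)

Definition int_rat : {pred rat} := fun q => q \is a Num.int.

Lemma int_rat_zmod_closed : zmod_closed int_rat.
Proof. by split=> [|x y]; [exact: rpred0 | exact: rpredB]. Qed.

HB.instance Definition _ :=
  GRing.isZmodClosed.Build _ int_rat int_rat_zmod_closed.

Definition rat_mod_int : zmodType := Quotient.quot int_rat.

Local Notation rat_mod_int_pi := \pi_(Quotient.quot int_rat).

Lemma rat_mod_int_divisible m (a : rat_mod_int) :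
  (0 < m)%N -> exists a', a' *+ m = a.
Proof.
move=> m0; have m_neq0 : m%:R != 0 :> rat by rewrite pnatr_eq0 -lt0n.
exists (rat_mod_int_pi (repr a / m%:R)).
rewrite -raddfMn -[(_ / _) *+ m]mulr_natr divfK//; exact: reprK.
Qed.

Lemma rat_mod_int_order m :
  (0 < m)%N -> exists t : rat_mod_int, forall k, t *+ k = 0 <-> (m %| k)%N.
Proof.
move=> m0; have m_neq0 : m%:R != 0 :> rat by rewrite pnatr_eq0 -lt0n.
exists (rat_mod_int_pi m%:R^-1) => k; rewrite -raddfMn; split.
  move=> /quot_pi_eq0/intrP[z kz].
  have kzm : k%:Z = z * m%:Z.
    apply: (@intr_inj rat); rewrite rmorphM /= -kz -!pmulrn.
    by rewrite mulrnAl mulVf.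
  by have : (m%:Z %| k%:Z)%Z by apply/dvdzP; exists z.
move=> /dvdnP[q ->]; apply/quot_pi_eq0.
by rewrite mulnC mulrnA -[_^-1 *+ m]mulr_natr mulVf// natr_int.
Qed.

Lemma rat_mod_int_inj : exists f : rat_mod_int -> nat, injective f.
Proof.
exists (fun t => choice.pickle (repr t)).
by move=> x y /(pcan_inj choice.pickleK)/(congr1 rat_mod_int_pi); rewrite !reprK.
Qed.

(** The identity of Q/Z recorded by its values at [1/n!]; it serves as [tau] in [univ_ge]. *)
Definition inv_fact (n : nat) : rat_mod_int := rat_mod_int_pi (n`!%:R^-1).

Lemma inv_fact0 : inv_fact 0 = 0.
Proof. by apply/quot_pi_eq0; rewrite fact0 invr1 unfold_in rpred1. Qed.

Lemma inv_factS n : inv_fact n.+1 *+ n.+1 = inv_fact n.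
Proof.
rewrite /inv_fact -raddfMn factS natrM invfM -[_ *+ n.+1]mulr_natl mulrA mulfV ?mul1r//.
by rewrite pnatr_eq0.
Qed.

Lemma inv_fact2 : inv_fact 2 != 0.
Proof. by apply/eqP => /quot_pi_eq0; rewrite unfold_in. Qed.

Close Scope quotient_scope.
Close Scope ring_scope.

Theorem theorem3p5 (L : Type)
    (hL : [set: L] #= [set: nat -> L])
    (hL2 : [set: nat -> bool] #<= [set: L]) :
  exists G : zmodType,
    [/\ infinite_set [set: G], is_reduced G, is_torsion_free G,
        [set: G] #= [set: L] &
        forall H : zmodType,
          infinite_set [set: H] -> is_reduced H -> is_torsion_free H ->
          [set: H] #<= [set: L] -> isomorphic_to_subgroup H G].
Proof.
have /card_leT_inj[cL cL_inj] : [set: nat -> L] #<= [set: L].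
  by move: hL; rewrite card_eq_le => /andP[].
have /card_leT_inj[cB cB_inj] := hL2.
(* Indicators of singletons embed [nat] into [L]; this codes the countable group Q/Z in [L] and also
   shows that [L] is infinite. *)
have cN_inj : injective (fun n : nat => cB (fun m => m == n)).
  by move=> n m /cB_inj/(congr1 (@^~ n)); rewrite eqxx => /esym/eqP.
have [cT cT_inj] := rat_mod_int_inj.
have L_le : [set: L] #<= [set: univ L rat_mod_int].
  exact: univ_ge inv_fact0 inv_factS inv_fact2.
have le_L : [set: univ L rat_mod_int] #<= [set: L].
  exact: univ_le (cB (fun=> true)) cL_inj (inj_comp cN_inj cT_inj).
exists (univ L rat_mod_int); split.
- apply/infiniteP; apply: card_le_trans L_le; apply/card_leT_inj.
  by exists (fun n : nat => cB (fun m => m == n)).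
- exact: univ_reduced.
- exact: univ_torsion_free.
- by rewrite card_eq_le le_L.
move=> H _ H_red H_tf /card_leT_inj[cH cH_inj].
(* The equality of [L] with its countable power absorbs the passage from [H] to sequences in [H]. *)
have cHN_inj : injective (fun f : nat -> H => cL (cH \o f)).
  move=> f g /cL_inj fg; apply/funext => n; apply: cH_inj.
  exact: (congr1 (fun h : nat -> L => h n) fg).
have [f f_inj] := univ_embedding rat_mod_int_divisible rat_mod_int_order
  H_red H_tf cHN_inj.
exists (fun y => `[< exists x, f x = y >]).
  split; first by apply/asboolP; exists 0%R; rewrite raddf0.
  move=> _ _ /asboolP[x <-] /asboolP[y <-]; apply/asboolP.
  by exists (x - y)%R; rewrite raddfB.
exists f; split=> [x _|x y _ _ /f_inj//|y /asboolP[x <-]]; last by exists x.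
by apply/asboolP; exists x.
Qed.
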